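(* Let $I$ be a non-principal monomial ideal of $R=K[x_1,\ldots,x_n]$. Then $$\mathrm{reg}(R/I)\geq \mathrm{reg}(R/\mathrm{sgn}(I)).$$
   Context: $K$ is a field and $R=K[x_1,\ldots,x_n]$ is a polynomial ring with the standard grading. For $a=(a_1,\ldots,a_n)\in\mathbb{N}^n$ (with $0\in\mathbb N$), $x^a:=x_1^{a_1}\cdots x_n^{a_n}$. A monomial ideal $I$ of $R$ has a unique finite minimal set of monomial generators $G(I)=\{x^{v_1},\ldots,x^{v_q}\}$. The incidence matrix of $I$ is the $n\times q$ matrix $A$ with columns $v_1,\ldots,v_q$. Signature: for each row $c=(c_1,\ldots,c_q)$ of $A$, list its distinct entries in ascending order $m_0<m_1<\cdots<m_r$, let $j_i$ be the index with $c_i=m_{j_i}$, and put $\mathrm{sgn}(c)=(j_1,\ldots,j_q)$. The matrix $\mathrm{sgn}(A)$ has rows $\mathrm{sgn}(c)$, with $c$ running over the rows of $A$. The signature $\mathrm{sgn}(I)$ is the ideal of $R$ generated by the monomials $x^w$ with $w$ a column of $\mathrm{sgn}(A)$. $\mathrm{reg}$ denotes Castelnuovo--Mumford regularity (as an $R$-module). *)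

(* Defs.v *)
From HB Require Import structures.
From mathcomp Require Import all_boot all_order all_algebra.
From mathcomp Require Import boolp classical_sets constructive_ereal.
(* The notations of mpoly clash with those of classical_sets: [mpoly n K] is
   {mpoly K[n]}, [multinom n] is 'X_{1..n} and [mpolyX K a] is 'X_[K, a]. *)
From mathcomp Require Import -(notations) mpoly.

Set Implicit Arguments.
Unset Strict Implicit.
Unset Printing Implicit Defensive.

Import Order.TTheory GRing.Theory Num.Theory.
Local Open Scope classical_set_scope.
Local Open Scope ring_scope.

Definition ideal (R : comNzRingType) (S : set R) : set R :=
  [set f | exists (m : nat) (c g : 'I_m -> R),
     (forall i, S (g i)) /\ f = \sum_i c i * g i].

Definition principal (R : comNzRingType) (I : set R) : Prop :=
  exists f : R, I = ideal [set f].

Section MonomialIdeals.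
Context (K : fieldType) (n : nat).

Definition monideal (S : set (multinom n)) : set (mpoly n K) :=
  ideal [set mpolyX K a | a in S].

Definition monomial_ideal (I : set (mpoly n K)) : Prop :=
  exists S : set (multinom n), I = monideal S.

(* S is the set of exponents of G(I). *)
Definition min_generators (I : set (mpoly n K)) (S : set (multinom n)) : Prop :=
  monideal S = I /\
  forall T : set (multinom n), T `<=` S -> monideal T = I -> T = S.

Definition column q (A : 'M[nat]_(n, q)) (j : 'I_q) : multinom n :=
  Multinom [tuple A i j | i < n].

Definition incidence_matrix (I : set (mpoly n K)) q (A : 'M[nat]_(n, q)) : Prop :=
  injective (column A) /\ min_generators I (range (column A)).

Definition sgn_mx q (A : 'M[nat]_(n, q)) : 'M[nat]_(n, q) :=
  \matrix_(i, j)
    index (A i j) (sort leq (undup [seq A i k | k <- enum 'I_q])).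

(* Incidence matrices of I differ only by a permutation of their columns, and
   sgn_mx commutes with such permutations, so quantifying over all of them
   yields the same generators as fixing one. *)
Definition sgn_ideal (I : set (mpoly n K)) : set (mpoly n K) :=
  monideal [set w | exists (q : nat) (A : 'M[nat]_(n, q)) (j : 'I_q),
                      incidence_matrix I A /\ w = column (sgn_mx A) j].

End MonomialIdeals.

Section Regularity.
Context (K : fieldType) (n : nat).

(* Homogeneous of degree d : int; 0 is homogeneous of every degree, and is the
   only homogeneous element of negative degree. *)
Definition homog (d : int) (p : mpoly n K) : Prop :=
  forall m : multinom n, m \in msupp p -> (mdeg m)%:Z = d.

Definition irrelevant_ideal : set (mpoly n K) :=
  ideal (range (fun i : 'I_n => mpolyX K (mnm1 i))).

(* Data  ... -> F_2 -> F_1 -> F_0 -> R  with F_i = R^(rk i), whose k-th basis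
   element sits in degree sh i k, i.e. F_i = \bigoplus_k R(- sh i k). Elements
   of F_i are row vectors; d_(i+1) is u |-> u *m dif i, and F_0 -> R is
   u |-> (u *m aug) 0 0. *)
Record free_seq := FreeSeq {
  rk  : nat -> nat;
  sh  : forall i, 'I_(rk i) -> int;
  dif : forall i, 'M[mpoly n K]_(rk i.+1, rk i);
  aug : 'cV[mpoly n K]_(rk 0)
}.

(* F is a minimal graded free resolution of R/J, where aug lifts the
   augmentation F_0 -> R/J to R. Its length is not bounded a priori, and
   eventual vanishing is rk i = 0 for large i. *)
Record min_resolution (J : set (mpoly n K)) (F : free_seq) : Prop := {
  dif_homog : forall i k l, homog (sh k - sh l) (dif F i k l);
  aug_homog : forall k, homog (sh k) (aug F k 0);
  aug_surj  : forall f, exists u : 'rV_(rk F 0), J (f - (u *m aug F) 0 0);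
  aug_exact : forall u : 'rV_(rk F 0),
    J ((u *m aug F) 0 0) <-> exists w : 'rV_(rk F 1), u = w *m dif F 0;
  dif_exact : forall i (u : 'rV_(rk F i.+1)),
    u *m dif F i = 0 <-> exists w : 'rV_(rk F i.+2), u = w *m dif F i.+1;
  dif_min   : forall i k l, irrelevant_ideal (dif F i k l)
}.

(* b_{i,j}: the number of copies of R(-j) in F_i. *)
Definition betti (F : free_seq) (i : nat) (j : int) : nat :=
  #|[pred k : 'I_(rk F i) | sh k == j]|.

(* reg (R/J) = max {j - i | b_{i,j}(R/J) != 0}, as a supremum in \bar int with
   the convention reg 0 = -oo. Minimal resolutions being unique up to
   isomorphism, all of them contribute the same set. *)
Definition reg_quotient (J : set (mpoly n K)) : \bar int :=
  supremum -oo%E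
    [set r | exists (F : free_seq) (i : nat) (j : int),
       [/\ min_resolution J F, betti F i j != 0 & r = (j - i%:Z)%:E]].

End Regularity.

(* Main.v *)
Require Import Defs.
From HB Require Import structures.
From mathcomp Require Import all_boot all_order all_algebra.
From mathcomp Require Import boolp classical_sets constructive_ereal.
From mathcomp Require Import -(notations) mpoly.

Set Implicit Arguments.
Unset Strict Implicit.
Unset Printing Implicit Defensive.

Import Order.TTheory GRing.Theory Num.Theory.
Local Open Scope classical_set_scope.
Local Open Scope ring_scope.

(** Write m_0 < m_1 < ... for the entries of a row of the incidence matrix A of
I. Sending k to m_k is a strictly increasing map of exponents, and extending it
to all natural numbers in every row t gives maps psi_t such that the map
a |-> psi a := (psi_1 a_1, ..., psi_n a_n) carries the generators of J := sgn(I)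
to those of I. The theorem is thus a case of [reg_relabel]: for strictly
increasing psi_t, replacing the generators s of a proper monomial ideal by psi s
cannot lower the regularity.

The reason is that a minimal multigraded resolution of R/J can be relabelled.
Its differentials are determined by scalars c_{kl} and the multidegrees of the
basis elements, the entries being c_{kl} x^(deg k - deg l); call these data a
frame. Exactness of the resolution can be tested in one multidegree b at a time,
where it concerns only the scalars whose basis elements have degree dividing b
([frame_min_resolution]). Replace every degree a other than that of the
generator of R/J by psi a. If b is divisible by x^(psi 0), there is a c
such that psi a divides b exactly when a divides c, so that the new frame in
degree b is the old one in degree c, and b lies in I exactly when c lies in J;
otherwise b is not in I, and nothing but the generator of R/I lives in degree b.
So the new frame gives a minimal resolution of R/I with the same ranks
([relabel_frame_resolves]), and its total degrees have not decreased, because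
psi_t k >= k.

Two ingredients remain. A frame for J exists ([frame_exists]): adding, degree by
degree, a basis of the new syzygies modulo those coming from smaller degrees
involves only degrees in the finite box bounded by the exponents of J, so each
step is finite-dimensional linear algebra. And an arbitrary graded minimal
resolution of R/J has the same degrees as the one obtained from the frame
([min_resolution_degrees]): lifting the identity of R/J both ways, the composite
is homotopic to the identity, hence equal to it modulo the irrelevant ideal.

The hypothesis that I is not principal serves to make sgn(I) a proper ideal: a
zero column of sgn(A) is a column of A that divides all the others. Finally,
incidence matrices exist by Dickson's lemma. *)

(** * Monomial ideals *)

Section MonomialMembership.
Context (K : fieldType) (n : nat).
Implicit Types (p q : mpoly n K) (m b : multinom n) (S : set (multinom n)).

Lemma mcoeffMXn p m b :
  mcoeff b (p * mpolyX K m) = if lem m b then mcoeff (mnm_sub b m) p else 0.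
Proof.
case: ifPn => mb.
  by rewrite -{1}(submK mb) addmC mcoeffMX.
apply/eqP; rewrite mcoeff_eq0 (perm_mem (msuppMX p m)).
by apply/mapP => -[k _ bE]; rewrite bE lem_addr in mb.
Qed.

Lemma monidealP S p :
  monideal S p <-> forall m, m \in msupp p -> exists2 s, S s & lem s m.
Proof.
split=> [[N [c [g [gS ->]]]] m|pS].
  rewrite mcoeff_msupp raddf_sum /= => nz.
  have [i ci0] : exists i, mcoeff m (c i * g i) != 0.
    apply/existsP/existsPn => z; case/eqP: nz.
    by rewrite big1 // => i _; apply/eqP; rewrite -[_ == _]negbK z.
  have [a Sa ga] := gS i; exists a => //.
  by move: ci0; rewrite -ga mcoeffMXn; case: ifP => //; rewrite eqxx.
have /choice [s sP] : forall m, exists s, m \in msupp p -> S s /\ lem s m.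
  move=> m; have [mp|_] := boolP (m \in msupp p); last by exists m.
  by have [s Ss sm] := pS m mp; exists s.
pose f m := mcoeff m p *: mpolyX K (mnm_sub m (s m)).
pose mon (i : 'I_(size (msupp p))) := tnth (in_tuple (msupp p)) i.
exists (size (msupp p)), (fun i => f (mon i)), (fun i => mpolyX K (s (mon i))).
have monP i : mon i \in msupp p by apply: mem_tnth.
split=> [i|]; first by exists (s (mon i)) => //; case: (sP _ (monP i)).
rewrite {1}[p]mpolyE big_tnth; apply: eq_bigr => i _.
have [_ /submK sE] := sP _ (monP i).
by rewrite /f -scalerAl -mpolyXD sE.
Qed.

Lemma monideal0 S : monideal S (0 : mpoly n K).
Proof. by apply/monidealP => m; rewrite mcoeff_msupp mcoeff0 eqxx. Qed.

Lemma monidealX S b : monideal S (mpolyX K b) <-> exists2 s, S s & lem s b.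
Proof.
split=> [/monidealP|Sb]; first by apply; rewrite msuppX inE.
by apply/monidealP => m; rewrite msuppX inE => /eqP ->.
Qed.

Lemma monideal_supp S p :
  monideal S p <-> forall m, m \in msupp p -> monideal S (mpolyX K m).
Proof.
split=> [/monidealP pS m /pS /monidealX //|pS].
by apply/monidealP => m /pS /monidealX.
Qed.

Lemma irrelevantP p : irrelevant_ideal p <-> mcoeff (@mnm0 n) p = 0.
Proof.
have -> : @irrelevant_ideal K n = monideal (range (@mnm1 n)).
  by rewrite /irrelevant_ideal /monideal image_comp.
split=> [/monidealP pS|p0].
  apply/eqP; rewrite mcoeff_eq0; apply/negP => /pS [_ [i _ <-]].
  by rewrite lep1mP mnm0E.
apply/monidealP => m mp.
have [i mi] : exists i, m i != 0%N.
  apply/existsP; apply: contraT => /existsPn m0.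
  have mE : m = mnm0 by apply/mnmP => i; rewrite mnm0E; apply/eqP/negPn/m0.
  by move: mp; rewrite mE mcoeff_msupp p0 eqxx.
by exists (mnm1 i); [exists i|rewrite lep1mP].
Qed.

End MonomialMembership.

Section MonidealClosure.
Context (K : fieldType) (n : nat) (S : set (multinom n)).
Implicit Types p q : mpoly n K.

Lemma monidealD p q : monideal S p -> monideal S q -> monideal S (p + q).
Proof.
move=> /monidealP Sp /monidealP Sq; apply/monidealP => m /msuppD_le.
by rewrite mem_cat => /orP[/Sp|/Sq].
Qed.

Lemma monidealM p q : monideal S q -> monideal S (p * q).
Proof.
move=> /monidealP Sq; apply/monidealP => m /msuppM_le.
case/allpairsP => -[a b] [_ bq ->].
have [s Ss sb] := Sq b bq; exists s => //.
exact: lepm_trans sb (lem_addl _ _).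
Qed.

Lemma monideal_mulmx a b (A : 'M[mpoly n K]_(a, b)) (v : 'cV_b) :
  (forall l, monideal S (v l 0)) -> forall k, monideal S ((A *m v) k 0).
Proof.
move=> Sv k; rewrite mxE; elim/big_ind: _ => //; first exact: monideal0.
- exact: monidealD.
- by move=> l _; apply: monidealM.
Qed.

End MonidealClosure.

(** * Homogeneous components *)

Section HomogeneousComponents.
Context (K : fieldType) (n : nat).
Implicit Types (p q : mpoly n K) (m : multinom n) (d e : int).

Definition hcomp d p : mpoly n K :=
  \sum_(m <- msupp p | (mdeg m)%:Z == d) mcoeff m p *: mpolyX K m.

Lemma mcoeff_hcomp d p m :
  mcoeff m (hcomp d p) = if (mdeg m)%:Z == d then mcoeff m p else 0.
Proof.
rewrite /hcomp raddf_sum /=.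
under eq_bigr => k _ do rewrite mcoeffZ mcoeffX.
have [mp|mp] := boolP (m \in msupp p); last first.
  rewrite (memN_msupp_eq0 mp) if_same big_seq_cond big1 // => k /andP[kp _].
  by case: eqP kp mp => [->->//|_ _ _]; rewrite mulr0.
rewrite big_mkcond (bigD1_seq m) ?msupp_uniq //= eqxx mulr1 big1 ?addr0 // => k.
by move/negPf => ->; rewrite mulr0 if_same.
Qed.

Lemma hcomp_is_additive d : zmod_morphism (hcomp d).
Proof.
move=> p q; apply/mpolyP => m; rewrite mcoeffB !mcoeff_hcomp mcoeffB.
by case: ifP; rewrite ?subrr.
Qed.
HB.instance Definition _ d :=
  GRing.isZmodMorphism.Build (mpoly n K) (mpoly n K) (hcomp d) (hcomp_is_additive d).

Lemma homogP d p : homog d p <-> hcomp d p = p.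
Proof.
split=> [hp|<- m].
  apply/mpolyP => m; rewrite mcoeff_hcomp; case: ifPn => // dm.
  apply/esym/memN_msupp_eq0; apply: contra dm => /hp <-; exact: eqxx.
by rewrite mcoeff_msupp mcoeff_hcomp; case: (_ =P d) => // _; rewrite eqxx.
Qed.

Lemma hcomp_homog d p : homog d (hcomp d p).
Proof.
by apply/homogP/mpolyP => m; rewrite !mcoeff_hcomp; case: (_ == d).
Qed.

(** Multiplying by a homogeneous element shifts the components. This is what
allows an arbitrary solution of a homogeneous linear system to be replaced by a
homogeneous one. *)
Lemma hcompM d e p q : homog e q -> hcomp d p * q = hcomp (d + e) (p * q).
Proof.
move=> hq; have ->: p * q = \sum_(m <- msupp p) mcoeff m p *: (mpolyX K m * q).
  by rewrite {1}[p]mpolyE mulr_suml; apply: eq_bigr => m _; rewrite scalerAl.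
rewrite raddf_sum /hcomp mulr_suml big_mkcond /=; apply: eq_bigr => m _.
rewrite -scalerAl; apply/mpolyP => k; rewrite mcoeff_hcomp [mpolyX K m * q]mulrC.
have [|] := boolP (k \in msupp (q * mpolyX K m)); last first.
  move/memN_msupp_eq0 => kz; rewrite (fun_if (mcoeff k)) !mcoeffZ kz mulr0 mcoeff0.
  by rewrite !if_same.
rewrite (perm_mem (msuppMX q m)) => /mapP[l lq ->]; rewrite mdegD PoszD (hq _ lq).
by rewrite (inj_eq (addIr e)) (fun_if (mcoeff _)) mcoeff0.
Qed.

Lemma monideal_hcomp (S : set (multinom n)) d p :
  monideal S p -> monideal S (hcomp d p).
Proof.
move=> /monidealP Sp; apply/monidealP => m; rewrite mcoeff_msupp mcoeff_hcomp.
by case: ifP => [_|_ /eqP//]; rewrite -mcoeff_msupp; apply: Sp.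
Qed.

End HomogeneousComponents.

(** * Frames and the resolutions they define *)

(** A complex of multigraded free modules without its monomials: basis element k
of the i-th module has multidegree [fdeg k], and the entry (k, l) of the
differential is to be multiplied by x^(fdeg k - fdeg l). *)
Record frame (K : fieldType) (n : nat) := Frame {
  frk : nat -> nat;
  fdeg : forall i, 'I_(frk i) -> multinom n;
  fmx : forall i, 'M[K]_(frk i.+1, frk i)
}.

Section Frames.
Context (K : fieldType) (n : nat).
Implicit Types (b c m : multinom n).

Definition below (F : frame K n) b i (w : 'rV[K]_(frk F i)) : Prop :=
  forall k, w 0 k != 0 -> lem (fdeg k) b.

(** The strand of a frame in degree b is the complex of K-vector spaces spanned by
the basis elements of degree dividing b. The last three conditions say that
every strand is a resolution of the degree b part of R/J, where J is generated
by the monomials with exponent in S; the strictness in [fmx_deg] is minimality.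
*)
Record frame_resolves (S : set (multinom n)) (F : frame K n) : Prop := {
  frk0 : frk F 0 = 1%N;
  fdeg0 : forall k : 'I_(frk F 0), fdeg k = @mnm0 n;
  fmx_deg : forall i k l, fmx F i k l != 0 ->
    lem (fdeg l) (fdeg k) /\ fdeg l != fdeg k;
  fmx_aug : forall b (u : 'rV[K]_(frk F 0)), u != 0 ->
    (exists2 s, S s & lem s b) <->
    (exists2 w, @below F b 1 w & u = w *m fmx F 0);
  fmx_comp : forall i, fmx F i.+1 *m fmx F i = 0;
  fmx_exact : forall b i (u : 'rV[K]_(frk F i.+1)),
    below b u -> u *m fmx F i = 0 ->
    exists2 w, @below F b i.+2 w & u = w *m fmx F i.+1
}.

Section Homogenization.
Context (F : frame K n).

Definition fdif i : 'M[mpoly n K]_(frk F i.+1, frk F i) :=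
  \matrix_(k, l) (fmx F i k l *: mpolyX K (mnm_sub (fdeg k) (fdeg l))).

Definition frame_seq : free_seq K n :=
  @FreeSeq K n (frk F) (fun i k => (mdeg (@fdeg _ _ F i k))%:Z) fdif
    (const_mx 1).

(** The part of multidegree b of an element of a free module, written in the basis
of the monomial multiples x^(b - fdeg k) of the basis elements. *)
Definition strand b i (u : 'rV[mpoly n K]_(frk F i)) : 'rV[K]_(frk F i) :=
  \row_k (if lem (fdeg k) b then mcoeff (mnm_sub b (fdeg k)) (u 0 k) else 0).

Definition unstrand b i (w : 'rV[K]_(frk F i)) : 'rV[mpoly n K]_(frk F i) :=
  \row_k (w 0 k *: mpolyX K (mnm_sub b (fdeg k))).

Lemma strand_is_additive b i : zmod_morphism (@strand b i).
Proof.
by move=> u v; apply/rowP => k; rewrite !mxE mcoeffB; case: ifP; rewrite ?subrr.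
Qed.
HB.instance Definition _ b i :=
  GRing.isZmodMorphism.Build 'rV[mpoly n K]_(frk F i) 'rV[K]_(frk F i)
    (@strand b i) (@strand_is_additive b i).

Lemma strand_below b i (u : 'rV[mpoly n K]_(frk F i)) : below b (strand b u).
Proof. by move=> k; rewrite mxE; case: ifP => //; rewrite eqxx. Qed.

Lemma strand_inj i (u v : 'rV[mpoly n K]_(frk F i)) :
  (forall b, strand b u = strand b v) -> u = v.
Proof.
move=> uv; apply/rowP => k; apply/mpolyP => m.
have /rowP/(_ k) := uv (mnm_add m (fdeg k)).
by rewrite !mxE lem_addl addmK.
Qed.

Lemma strandK b c i (w : 'rV[K]_(frk F i)) :
  below b w -> strand c (unstrand b w) = if b == c then w else 0.
Proof.
move=> bw; apply/rowP => k; rewrite !mxE mcoeffZ mcoeffX.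
have [wk0|/eqP/bw kb] := (w 0 k =P 0).
  by rewrite wk0 mul0r if_same; case: ifP; rewrite ?mxE ?wk0.
case: ifPn => [kc|]; last first.
  by case: eqP => [<-|_ _]; rewrite ?kb ?mxE.
have -> : (mnm_sub b (fdeg k) == mnm_sub c (fdeg k)) = (b == c).
  by rewrite -(eqm_add2r (fdeg k)) !submK.
by case: eqP; rewrite ?mulr1 ?mulr0 ?mxE.
Qed.

Lemma strand_finite i (u : 'rV[mpoly n K]_(frk F i)) :
  exists2 s : seq (multinom n), uniq s & forall b, strand b u != 0 -> b \in s.
Proof.
pose T k := [seq mnm_add m (fdeg k) | m <- msupp (u 0 k)].
exists (undup (flatten [seq T k | k <- enum 'I_(frk F i)])) => [|b].
  exact: undup_uniq.
case/rV0Pn => k; rewrite mxE mem_undup; case: ifP => [kb|]; last by rewrite eqxx.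
rewrite -mcoeff_msupp => bm; apply/flatten_mapP; exists k; first by rewrite mem_enum.
by apply/mapP; exists (mnm_sub b (fdeg k)); rewrite ?submK.
Qed.

End Homogenization.

Section HomogenizedResolution.
Context (S : set (multinom n)) (F : frame K n).
Hypothesis resF : frame_resolves S F.

(** If c is the entry (k, l) of [fmx F i] and c != 0, then deg l divides deg k, and
the entry c x^(deg k - deg l) carries x^(b - deg k) to c x^(b - deg l). *)
Lemma strand_mul b i (u : 'rV[mpoly n K]_(frk F i.+1)) :
  strand b (u *m fdif F i) = strand b u *m fmx F i.
Proof.
apply/rowP => l; rewrite !mxE raddf_sum /= (fun_if (fun x => x)).
have -> : forall (B : bool) (T : finType) (f : T -> K),
    (if B then \sum_k f k else 0) = \sum_k if B then f k else 0.
  by case=> //= T f; rewrite big1.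
apply: eq_bigr => k _; rewrite !mxE -scalerAr mcoeffZ mcoeffMXn.
have [->|/eqP/(fmx_deg resF)[lk _]] := (fmx F i k l =P 0).
  by rewrite mul0r mulr0 if_same.
have [kb|kb] := boolP (lem (fdeg k) b); last first.
  rewrite mul0r; case: ifP => // lb; case: ifPn => [bl|_]; last by rewrite mulr0.
  case/negP: kb; apply/mnm_lepP => j; move/mnm_lepP: lb => /(_ j) lb.
  by move/mnm_lepP: bl => /(_ j); rewrite !mnmBE leq_subLR subnKC.
rewrite (lepm_trans lk kb) mulrC.
have bkl : mnm_sub b (fdeg l) =
    mnm_add (mnm_sub b (fdeg k)) (mnm_sub (fdeg k) (fdeg l)).
  by apply: (@addIm _ (fdeg l)); rewrite -addmA !submK // (lepm_trans lk).
by rewrite bkl lem_addl addmK.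
Qed.

(** Images can be tested strand by strand: preimages of the strands can be chosen
independently, and only finitely many strands of u are nonzero, so the chosen
preimages add up. *)
Lemma strand_image i (u : 'rV[mpoly n K]_(frk F i)) :
  (exists W, u = W *m fdif F i) <->
  (forall b, exists2 w, below b w & strand b u = w *m fmx F i).
Proof.
split=> [[W ->] b|uw].
  by exists (strand b W); [apply: strand_below|rewrite strand_mul].
have /choice [w wP] : forall b, exists w, below b w /\ strand b u = w *m fmx F i.
  by move=> b; have [w] := uw b; exists w.
have [s us sP] := strand_finite u.
exists (\sum_(b <- s) unstrand b (w b)); apply: strand_inj => c.
rewrite strand_mul raddf_sum /=.
under eq_bigr => b _ do (rewrite strandK; last by case: (wP b)).
have [cs|cs] := boolP (c \in s).
  rewrite (bigD1_seq c) //= eqxx big1 ?addr0; first by case: (wP c).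
  by move=> b /negPf ->.
rewrite big_seq big1 ?mul0mx => [|b]; last by case: eqP cs => // -> /negPf ->.
by apply/eqP; apply: contraNT cs => /sP.
Qed.

Lemma frame_min_resolution : min_resolution (@monideal K n S) (frame_seq F).
Proof.
have [k0 _ k0P] : exists2 k0 : 'I_(frk F 0), true & all_equal_to k0.
  have r0 := frk0 resF; have lt0 : (0 < frk F 0)%N by rewrite r0.
  exists (Ordinal lt0) => // -[k lk]; apply/val_inj => /=.
  by move: lk; rewrite {1}r0; case: k.
have augE (u : 'rV_(frk F 0)) : (u *m aug (frame_seq F)) 0 0 = u 0 k0.
  rewrite mxE (bigD1 k0) //= big1 ?addr0 ?mxE ?mulr1 // => k.
  by rewrite (k0P k) eqxx.
have strand0 b (u : 'rV[mpoly n K]_(frk F 0)) :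
    (strand b u != 0) = (b \in msupp (u 0 k0)).
  rewrite mcoeff_msupp; apply/rV0Pn/idP => [[k]|nz]; [|exists k0].
    by rewrite mxE (k0P k) (fdeg0 resF) subm0; case: ifP => //; rewrite eqxx.
  rewrite mxE (fdeg0 resF) subm0; case: ifP => // /negP[].
  by apply/mnm_lepP => j; rewrite mnm0E.
split=> /=.
- move=> i k l m; rewrite mxE.
  have [->|nz] := eqVneq (fmx F i k l) 0; first by rewrite scale0r msupp0.
  have [/submK lk _] := fmx_deg resF nz.
  by rewrite msuppMCX // inE => /eqP ->; rewrite -[in RHS]lk mdegD PoszD addrK.
- by move=> k m; rewrite mxE msupp1 inE (fdeg0 resF) => /eqP ->.
- move=> f; exists (const_mx f); rewrite augE mxE subrr; exact: monideal0.
- move=> u; rewrite augE strand_image // monideal_supp; split=> [uS b|uw m].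
    have [->|nz] := eqVneq (strand b u) 0.
      by exists 0; [move=> k; rewrite mxE eqxx|rewrite mul0mx].
    by apply/(fmx_aug resF b nz)/monidealX/uS; rewrite -strand0.
  rewrite -strand0 => nz; apply/monidealX.
  by apply/(fmx_aug resF m nz)/uw.
- move=> i u; rewrite strand_image //; split=> [u0 b|uw].
    apply: (fmx_exact resF); first exact: strand_below.
    by rewrite -strand_mul // u0 raddf0.
  apply: strand_inj => b; rewrite strand_mul // raddf0.
  by have [w _ ->] := uw b; rewrite -mulmxA (fmx_comp resF) mulmx0.
- move=> i k l; apply/irrelevantP; rewrite mxE mcoeffZ mcoeffX.
  have [->|nz] := eqVneq (fmx F i k l) 0; first by rewrite mul0r.
  have [lk /negPf ne] := fmx_deg resF nz.
  rewrite -(eqm_add2r (fdeg l)) submK // add0m eq_sym ne mulr0 //.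
Qed.

End HomogenizedResolution.

(** * Relabelling degrees *)

Section Relabelling.
Context (psi : 'I_n -> nat -> nat).
Hypothesis psi_incr : forall t, {homo psi t : x y / (x < y)%N}.

Definition relabel m : multinom n := Multinom [tuple psi i (m i) | i < n].

(** The generator of R/J in homological degree 0 keeps degree 0; relabelling it
would shift the whole module when psi 0 is not 0. *)
Definition relabel_frame (F : frame K n) : frame K n :=
  @Frame K n (frk F)
    (fun i k => if i is 0 then @mnm0 n else relabel (@fdeg _ _ F i k))
    (fmx F).

Lemma relabelE m i : relabel m i = psi i (m i).
Proof. by rewrite mnmE. Qed.

Lemma psi_mono t : {mono psi t : x y / (x <= y)%N}.
Proof. exact/leq_mono/psi_incr. Qed.

Lemma leq_psi t x : (x <= psi t x)%N.
Proof. by elim: x => // x IH; apply: leq_ltn_trans IH _; apply: psi_incr. Qed.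

Lemma relabel_le m b : lem (relabel m) (relabel b) = lem m b.
Proof.
apply/mnm_lepP/mnm_lepP => mb i; have := mb i; by rewrite !relabelE psi_mono.
Qed.

Lemma relabel_inj : injective relabel.
Proof.
move=> a b ab; apply/mnmP => i; apply/eqP; rewrite eqn_leq.
have E : psi i (a i) = psi i (b i) by rewrite -!relabelE ab.
by rewrite -(psi_mono i) -[X in _ && X](psi_mono i) E leqnn.
Qed.

Lemma mdeg_relabel m : (mdeg m <= mdeg (relabel m))%N.
Proof. by rewrite !mdegE leq_sum // => i _; rewrite relabelE leq_psi. Qed.

(** Where it has a chance to exist, psi has a right adjoint for divisibility:
coordinatewise, c is the largest exponent whose image is at most that of b. *)
Lemma relabel_adjoint b : lem (relabel (@mnm0 n)) b ->
  exists c, forall m, lem (relabel m) b = lem m c.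
Proof.
move=> b0.
have /choice [c cP] : forall i, exists y, forall x, (psi i x <= b i)%N = (x <= y)%N.
  move=> i; have ex0 : exists x, (psi i x <= b i)%N.
    by exists 0%N; move/mnm_lepP: b0 => /(_ i); rewrite relabelE mnm0E.
  have ub x : (psi i x <= b i)%N -> (x <= b i)%N.
    exact/leq_trans/leq_psi.
  exists (ex_maxn ex0 ub) => x; case: ex_maxnP => y yb ymax.
  apply/idP/idP => [/ymax//|xy]; apply: leq_trans yb.
  by rewrite psi_mono.
exists (Multinom [tuple c i | i < n]) => m.
by apply/mnm_lepP/mnm_lepP => mb i; move: (mb i); rewrite relabelE mnmE cP.
Qed.

(** By the adjunction, strands of the relabelled frame are strands of the original
one, or reduce to the generator of R/J in the degrees not divisible by
x^(psi 0). *)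
Lemma relabel_frame_resolves S F : frame_resolves S F ->
  frame_resolves [set relabel s | s in S] (relabel_frame F).
Proof.
move=> resF.
have lem0 b : lem (@mnm0 n) b by apply/mnm_lepP => j; rewrite mnm0E.
have high b : ~~ lem (relabel (@mnm0 n)) b -> forall i w,
    @below (relabel_frame F) b i.+1 w -> w = 0.
  move=> bN i w bw; apply/rowP => k; rewrite mxE; apply/eqP.
  apply: contraNT bN => /bw /=; apply: lepm_trans; rewrite relabel_le; exact: lem0.
have low b c : (forall m, lem (relabel m) b = lem m c) -> forall i w,
    @below (relabel_frame F) b i w <-> @below F c i w.
  move=> bc [|i] w; split=> bw k /bw //=; rewrite ?bc //.
  by rewrite (fdeg0 resF).
split=> //=.
- exact: (frk0 resF).
- move=> [|i] k l nz; have [lk ne] := fmx_deg resF nz; last first.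
    by rewrite relabel_le (inj_eq relabel_inj).
  split; first exact: lem0.
  apply: contraNneq ne => /esym r0; rewrite (fdeg0 resF); apply/eqP/esym/mnmP => t.
  apply/eqP; rewrite mnm0E -leqn0; apply: leq_trans (leq_psi t _) _.
  by rewrite -relabelE r0 mnm0E.
- move=> b u nz; case: (boolP (lem (relabel (@mnm0 n)) b)) => [|bN].
    move=> /relabel_adjoint [c bc]; have := fmx_aug resF c nz => augc.
    split=> [[_ [s Ss <-]]|[w /(low b c bc) wc uw]].
      rewrite bc => sc; have [|w wc uw] := augc.1; first by exists s.
      by exists w => //; apply/(low b c bc).
    have [|s Ss sc] := augc.2; first by exists w.
    by exists (relabel s); [exists s|rewrite bc].
  split=> [[_ [s _ <-] sb]|[w /(high b bN) -> u0]].
    by case/negP: bN; apply: lepm_trans sb; rewrite relabel_le.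
  by case/eqP: nz; rewrite u0 mul0mx.
- exact: (fmx_comp resF).
- move=> b i u bu u0; case: (boolP (lem (relabel (@mnm0 n)) b)) => [|bN].
    move=> /relabel_adjoint [c bc].
    have [|w wc ->] := fmx_exact resF (b := c) _ u0; first exact/(low b c bc).
    by exists w => //; apply/(low b c bc).
  rewrite (high b bN _ _ bu); exists 0; last by rewrite mul0mx.
  by move=> k; rewrite mxE eqxx.
Qed.

End Relabelling.
End Frames.

(** * Existence of frames *)

Section MinimalCovers.
Context (K : fieldType) (T : finType) (le : rel T).
Hypothesis le_refl : reflexive le.
Hypothesis le_trans : transitive le.
Hypothesis le_anti : antisymmetric le.

Record family (r : nat) := Family {
  fam_size : nat;
  fam_deg : 'I_fam_size -> T;
  fam_mx : 'M[K]_(fam_size, r)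
}.

(** The coordinate projection onto the basis vectors of degree below b; as a
subspace of K^m it is represented by its row space. *)
Definition upto m (t : 'I_m -> T) (b : T) : 'M[K]_m :=
  diag_mx (\row_k (le (t k) b)%:R).

(** Generators of a filtered vector space W. By [cover_min], syzygies of degree b
do not involve generators of degree b, which is how minimality of a resolution
shows in its next differential. *)
Record min_cover r (W : T -> 'M[K]_r) (c : family r) : Prop := {
  cover_in : forall k, (row k (fam_mx c) <= W (fam_deg k))%MS;
  cover_gen : forall b, (W b <= upto (@fam_deg _ c) b *m fam_mx c)%MS;
  cover_min : forall b (w : 'rV[K]_(fam_size c)),
    (w <= upto (@fam_deg _ c) b)%MS -> w *m fam_mx c = 0 ->
    forall k, fam_deg k = b -> w 0 k = 0
}.

Lemma sub_upto m (t : 'I_m -> T) b (w : 'rV[K]_m) :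
  (w <= upto t b)%MS <-> (forall k, w 0 k != 0 -> le (t k) b).
Proof.
split=> [/submxP[v ->] k|wb].
  rewrite mul_mx_diag !mxE; case: le => //; by rewrite mulr0 eqxx.
apply/submxP; exists w; apply/rowP => k; rewrite mul_mx_diag !mxE.
by have [->|/wb ->] := eqVneq (w 0 k) 0; rewrite ?mul0r ?mulr1.
Qed.

Lemma uptoS m (t : 'I_m -> T) b c : le b c -> upto t b *m upto t c = upto t b.
Proof.
move=> bc; rewrite /upto mulmx_diag; congr diag_mx; apply/rowP => k; rewrite !mxE.
have [tb|_] := boolP (le (t k) b); last by rewrite mul0r.
by rewrite (le_trans tb bc) mulr1.
Qed.

(** In each degree b, take a basis of a complement C b in W b of the sum V b of the
W c for c strictly below b. These vectors generate by induction on b; and a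
relation between vectors of degree below b puts a combination of the basis of
C b into V b, so this combination vanishes. *)
Lemma min_cover_exists r (W : T -> 'M[K]_r) :
  (forall b c, le b c -> (W b <= W c)%MS) -> exists c, min_cover W c.
Proof.
move=> Wmono.
pose V b := (\sum_(c | le c b && (c != b)) W c)%MS.
have VW b : (V b <= W b)%MS by apply/sumsmx_subP => c /andP[/Wmono].
pose C b := (W b :\: V b)%MS.
pose P := {b : T & 'I_(\rank (C b))}.
pose t (k : 'I_#|{: P}|) := tag (enum_val k).
pose brow (p : P) : 'rV[K]_r := row (tagged p) (row_base (C (tag p))).
pose M : 'M[K]_(#|{: P}|, r) := \matrix_k brow (enum_val k).
have rowM k : row k M = brow (enum_val k) by rewrite rowK.
have brow_sub p : (brow p <= C (tag p))%MS.
  by apply: submx_trans (row_sub _ _) _; rewrite eq_row_base.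
have WE b : (W b <= C b + V b)%MS.
  by rewrite -(addsmx_diff_cap_eq (W b) (V b)) addsmxS // capmxSr.
exists (Family t M); split=> /=.
- by move=> k; rewrite rowM (submx_trans (brow_sub _)) // diffmxSl.
- move=> b; have [N] := ubnP #|[pred c | le c b]|; elim: N b => // N IH b leN.
  apply: submx_trans (WE b) _; rewrite addsmx_sub; apply/andP; split.
    rewrite -(eq_row_base (C b)); apply/row_subP => i.
    pose p : P := Tagged (fun b => 'I_(\rank (C b))) i.
    have -> : row i (row_base (C b)) = row (enum_rank p) (upto t b *m M).
      by apply/rowP => j; rewrite mul_diag_mx !mxE /t !enum_rankK /= le_refl mul1r.
    exact: row_sub.
  apply/sumsmx_subP => c /andP[cb c_b].
  apply: submx_trans (IH c _) _; last by rewrite -(uptoS t cb) -mulmxA submxMl.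
  rewrite -ltnS; apply: leq_trans leN; rewrite ltnS; apply: proper_card.
  apply/properP; split.
    by apply/fintype.subsetP => d; rewrite !inE => /le_trans; apply.
  exists b; rewrite !inE ?le_refl //.
  by apply: contra c_b => bc; apply/eqP/le_anti; rewrite bc cb.
(* z c collects the coefficients of w at the basis vectors of C c *)
move=> b w /sub_upto wb wM k kb.
pose z c : 'rV[K]_(\rank (C c)) :=
  \row_i w 0 (enum_rank (Tagged (fun b => 'I_(\rank (C b))) i : P)).
have wE : w *m M = \sum_c z c *m row_base (C c).
  rewrite mulmx_sum_row (reindex (@enum_rank P)) /=; last first.
    by apply: onW_bij; apply: enum_rank_bij.
  under [RHS]eq_bigr => c _ do rewrite mulmx_sum_row.
  rewrite sig_big_dep /=; apply: eq_bigr => -[c i] _.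
  by rewrite rowM enum_rankK mxE.
have zb0 : z b = 0.
  apply/eqP; rewrite -(mulmx_free_eq0 _ (row_base_free (C b))) -submx0.
  rewrite -(capmx_diff (W b) (V b)) sub_capmx; apply/andP; split.
    by rewrite (submx_trans (submxMl _ _)) // eq_row_base.
  move: wM; rewrite wE (bigD1 b) //= => /eqP; rewrite addr_eq0 => /eqP ->.
  rewrite eqmx_opp; apply: summx_sub => c c_b.
  have [cb|cb] := boolP (le c b).
    apply: (submx_trans (submxMl _ _)); rewrite eq_row_base.
    apply: (submx_trans (diffmxSl _ _)).
    by apply: (sumsmx_sup c) => //; rewrite cb.
  suff -> : z c = 0 by rewrite mul0mx sub0mx.
  apply/rowP => i; rewrite !mxE; apply/eqP; apply: contraNT cb => /wb.
  by rewrite /t enum_rankK.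
have pE (p : P) : Tagged (fun b => 'I_(\rank (C b))) (tagged p) = p by case: p.
move: zb0; rewrite -kb => /rowP/(_ (tagged (enum_val k))).
by rewrite !mxE pE enum_valK.
Qed.

End MinimalCovers.
Arguments upto {K T} le {m} t b.

(** Degrees are taken in a finite type T embedded by dg in the monomials, in such a
way that every monomial b has a largest divisor dg (tr b) in T; the strands in
degrees b and dg (tr b) of a frame with degrees in T are then the same. *)
Section FrameExistence.
Context (K : fieldType) (n : nat) (T : finType) (dg : T -> multinom n).
Context (tr : multinom n -> T) (S : set (multinom n)).
Hypothesis dg_inj : injective dg.
Hypothesis trP : forall t b, lem (dg t) (dg (tr b)) = lem (dg t) b.
Hypothesis S_dg : forall s, S s -> exists t, dg t = s.
Hypothesis S_proper : ~ S (@mnm0 n).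

Let le : rel T := fun t u => lem (dg t) (dg u).

Let le_refl : reflexive le. Proof. by move=> t; apply: lepm_refl. Qed.
Let le_trans : transitive le. Proof. by move=> u t v; apply: lepm_trans. Qed.
Let le_anti : antisymmetric le.
Proof.
move=> t u /andP[/mnm_lepP tu /mnm_lepP ut]; apply/dg_inj/mnmP => i.
by apply/eqP; rewrite eqn_leq tu ut.
Qed.

(** In homological degree 0 there is the single basis element 1 of R, and the
strand to be covered is the degree b part of J, which is K or 0. *)
Definition mem_strand (b : T) : 'M[K]_1 :=
  if `[< exists2 s, S s & lem s (dg b) >] then 1%:M else 0.

Definition syz_strand r (c : family K T r) (b : T) : 'M[K]_(fam_size c) :=
  (upto le (@fam_deg _ _ _ c) b :&: kermx (fam_mx c))%MS.

Lemma mem_strandS b c : le b c -> (mem_strand b <= mem_strand c)%MS.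
Proof.
rewrite /mem_strand => bc; case: asboolP => [[s Ss sb]|]; last by rewrite sub0mx.
case: asboolP => // -[]; exists s => //; exact: lepm_trans bc.
Qed.

Lemma syz_strandS r (f : family K T r) b c :
  le b c -> (syz_strand f b <= syz_strand f c)%MS.
Proof.
by move=> bc; rewrite capmxS // -(uptoS K le_trans _ bc) submxMl.
Qed.

Definition syz_family r (c : family K T r) : family K T (fam_size c) :=
  projT1 (cid (min_cover_exists le_refl le_trans le_anti (@syz_strandS r c))).

Lemma syz_familyP r (c : family K T r) :
  min_cover le (syz_strand c) (syz_family c).
Proof. exact: projT2 (cid _). Qed.

Definition gen_family : family K T 1 :=
  projT1 (cid (min_cover_exists le_refl le_trans le_anti mem_strandS)).

Lemma gen_familyP : min_cover le mem_strand gen_family.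
Proof. exact: projT2 (cid _). Qed.

(** A family over K^r is stored with r, so that the number of vectors in one stage
is by computation the dimension of the next. *)
Fixpoint stage (i : nat) : {r : nat & family K T r} :=
  if i is i'.+1 then Tagged (family K T) (syz_family (tagged (stage i')))
  else Tagged (family K T) gen_family.

Definition free_frame : frame K n :=
  @Frame K n (fun i => tag (stage i))
    (fun i => match i return 'I_(tag (stage i)) -> multinom n with
              | 0 => fun _ => @mnm0 n
              | i'.+1 => fun k => dg (@fam_deg _ _ _ (tagged (stage i')) k)
              end)
    (fun i => fam_mx (tagged (stage i))).

Lemma below_upto i b (w : 'rV[K]_(frk free_frame i.+1)) :
  below b w <-> (w <= upto le (@fam_deg _ _ _ (tagged (stage i))) (tr b))%MS.
Proof.
rewrite sub_upto; split=> wb k /wb; last by rewrite /le trP.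
by rewrite /le trP.
Qed.

Lemma trS b :
  (exists2 s, S s & lem s b) <-> (exists2 s, S s & lem s (dg (tr b))).
Proof.
by split=> -[s Ss sb]; exists s => //; have [t ts] := S_dg Ss;
  move: sb; rewrite -ts trP.
Qed.

Lemma free_frame_gen i b w :
  (w <= upto le (@fam_deg _ _ _ (tagged (stage i))) (tr b) *m
     fam_mx (tagged (stage i)))%MS ->
  exists2 v, @below _ _ free_frame b i.+1 v & w = v *m fmx free_frame i.
Proof.
case/submxP => v ->.
exists (v *m upto le (@fam_deg _ _ _ (tagged (stage i))) (tr b)).
  by apply/below_upto; rewrite submxMl.
by rewrite mulmxA.
Qed.

Lemma free_frame_resolves : frame_resolves S free_frame.
Proof.
have mem1 (M : 'M[K]_1) : M != 0 -> (1%:M <= M)%MS.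
  move=> nz; apply: submx_full; rewrite row_full_unit unitmxE det_mx11 unitfE.
  apply: contraNneq nz => M0; apply/eqP/matrixP => i j.
  by rewrite !ord1 M0 mxE.
have compE i : fmx free_frame i.+1 *m fmx free_frame i = 0.
  apply/row_matrixP => k; rewrite row0 row_mul.
  have := cover_in (syz_familyP (tagged (stage i))) k.
  by rewrite sub_capmx => /andP[_ /sub_kermxP].
split=> //.
- move=> [|i] k l nz.
    have := cover_in gen_familyP k; rewrite /mem_strand.
    case: asboolP => [[s Ss sk] _|_ /submxP[v]]; last first.
      rewrite mulmx0 => /rowP/(_ l); rewrite !mxE => kl.
      by case/eqP: nz.
    split; first by apply/mnm_lepP => j; rewrite mnm0E.
    apply/eqP => k0; case: S_proper; suff <- : s = @mnm0 n by [].
    apply/mnmP => j; apply/eqP; rewrite mnm0E -leqn0.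
    by move: k0 => /= k0; have /mnm_lepP/(_ j) := sk; rewrite -k0 mnm0E.
  have := cover_in (syz_familyP (tagged (stage i))) k.
  rewrite sub_capmx => /andP[kb /sub_kermxP ker].
  have /sub_upto/(_ l) lk := kb.
  have nzl : row k (fam_mx (syz_family (tagged (stage i)))) 0 l != 0 by rewrite mxE.
  split; first exact: lk.
  apply: contra nzl => /eqP/dg_inj ekl; apply/eqP.
  case: i k l nz kb ker lk ekl => [|i] k l nz kb ker lk ekl.
    exact: (cover_min gen_familyP kb ker ekl).
  exact: (cover_min (syz_familyP (tagged (stage i))) kb ker ekl).
- move=> b u nz; rewrite trS; split=> [Sb|[w /below_upto wb uw]].
    apply: (@free_frame_gen 0).
    apply: submx_trans (cover_gen gen_familyP (tr b)); rewrite /mem_strand.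
    case: asboolP => // _; exact: submx1.
  have : (u <= mem_strand (tr b))%MS.
    rewrite uw mulmx_sum_row; apply: summx_sub => k _.
    have [->|nk] := eqVneq (w 0 k) 0; first by rewrite scale0r sub0mx.
    apply: scalemx_sub; apply: submx_trans (cover_in gen_familyP k) _.
    apply: mem_strandS; move/sub_upto: wb; exact.
  rewrite /mem_strand; case: asboolP => // _ /submxP[v].
  by rewrite mulmx0 => u0; rewrite u0 eqxx in nz.
- move=> b i u /below_upto ub u0; apply: free_frame_gen.
  apply: submx_trans (cover_gen (syz_familyP (tagged (stage i))) (tr b)).
  by rewrite sub_capmx ub; apply/sub_kermxP.
Qed.

End FrameExistence.

(** Degrees in the box [0, N]^n suffice: every monomial b has a largest divisor in
it, namely the componentwise minimum of b and N. *)
Lemma frame_exists (K : fieldType) (n N : nat) (S : set (multinom n)) :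
  (forall s, S s -> forall i, (s i <= N)%N) -> ~ S (@mnm0 n) ->
  exists F : frame K n, frame_resolves S F.
Proof.
move=> SN S0.
pose dg (t : {ffun 'I_n -> 'I_N.+1}) := Multinom [tuple t i : nat | i < n].
pose tr (b : multinom n) : {ffun 'I_n -> 'I_N.+1} :=
  [ffun i => inord (minn N (b i))].
have dgE t i : dg t i = t i by rewrite mnmE.
have dg_tr b i : dg (tr b) i = minn N (b i).
  by rewrite dgE ffunE inordK // ltnS geq_minl.
have dg_inj : injective dg.
  by move=> t u tu; apply/ffunP => i; apply/val_inj; rewrite /= -!dgE tu.
exists (free_frame K S dg_inj).
apply: (@free_frame_resolves _ _ _ dg tr) => // [t b|s Ss].
  apply/mnm_lepP/mnm_lepP => tb i; move: (tb i); rewrite dg_tr dgE leq_min.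
    by case/andP.
  by move=> ->; rewrite andbT -ltnS ltn_ord.
exists (tr s); apply/mnmP => i; rewrite dg_tr; apply/minn_idPr; exact: SN.
Qed.

(** * Uniqueness of the degrees of a minimal resolution *)

Section HomogeneousMatrices.
Context (K : fieldType) (n a b : nat).
Context (sa : 'I_a -> int) (sb : 'I_b -> int).

(** The homogeneous part of degree 0 of a map between graded free modules whose
basis elements have degrees sa and sb. *)
Definition hcomp_mx (A : 'M[mpoly n K]_(a, b)) : 'M[mpoly n K]_(a, b) :=
  \matrix_(k, l) hcomp (sa k - sb l) (A k l).

Lemma hcomp_mx_id (A : 'M[mpoly n K]_(a, b)) :
  (forall k l, homog (sa k - sb l) (A k l)) -> hcomp_mx A = A.
Proof. by move=> hA; apply/matrixP => k l; rewrite mxE; apply/homogP. Qed.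

Lemma hcomp_mx_homog (A : 'M[mpoly n K]_(a, b)) k l :
  homog (sa k - sb l) (hcomp_mx A k l).
Proof. by rewrite mxE; apply: hcomp_homog. Qed.

End HomogeneousMatrices.

Lemma hcomp_mxM (K : fieldType) (n a b c : nat)
    (sa : 'I_a -> int) (sb : 'I_b -> int) (sc : 'I_c -> int)
    (A : 'M[mpoly n K]_(a, b)) (D : 'M_(b, c)) :
  (forall k l, homog (sb k - sc l) (D k l)) ->
  hcomp_mx sa sb A *m D = hcomp_mx sa sc (A *m D).
Proof.
move=> hD; apply/matrixP => k j; rewrite !mxE raddf_sum; apply: eq_bigr => l _ /=.
by rewrite mxE (hcompM _ _ (hD l j)) addrA subrK.
Qed.

Section Comparison.
Context (K : fieldType) (n : nat) (S : set (multinom n)).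
Implicit Types F G : free_seq K n.
Local Notation J := (@monideal K n S).

(** The maps that occur in homological degree i of some chain map F -> G lifting the
identity of R/J. *)
Inductive aug_lift F G : forall i, 'M[mpoly n K]_(rk F i, rk G i) -> Prop :=
| AugLift0 (A : 'M_(rk F 0, rk G 0)) :
    (forall k, J ((aug F - A *m aug G) k 0)) -> aug_lift A
| AugLiftS i (A : 'M_(rk F i, rk G i)) (B : 'M_(rk F i.+1, rk G i.+1)) :
    aug_lift A -> B *m dif G i = dif F i *m A -> aug_lift B.

Section Factoring.
Context (F : free_seq K n).
Hypothesis resF : min_resolution J F.

Lemma factor_rows a b c (A : 'M[mpoly n K]_(a, c)) (D : 'M_(b, c)) :
  (forall k, exists w, row k A = w *m D) -> exists W, A = W *m D.
Proof.
move=> /choice [w wP]; exists (\matrix_k w k); apply/row_matrixP => k.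
by rewrite row_mul rowK.
Qed.

Lemma aug_factor a (A : 'M[mpoly n K]_(a, rk F 0)) :
  (forall k, J ((A *m aug F) k 0)) -> exists W, A = W *m dif F 0.
Proof.
move=> AJ; apply: factor_rows => k; apply/(aug_exact resF).
by rewrite -row_mul mxE.
Qed.

Lemma dif_factor a i (A : 'M[mpoly n K]_(a, rk F i.+1)) :
  A *m dif F i = 0 -> exists W, A = W *m dif F i.+1.
Proof.
move=> A0; apply: factor_rows => k; apply/(dif_exact resF).
by rewrite -row_mul A0 row0.
Qed.

Lemma dif_aug k : J ((dif F 0 *m aug F) k 0).
Proof.
have /(_ (row k (dif F 0)))/iffRL := aug_exact resF.
rewrite -row_mul mxE; apply; exists (delta_mx 0 k); by rewrite -rowE.
Qed.

Lemma dif_comp i : dif F i.+1 *m dif F i = 0.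
Proof.
apply/row_matrixP => k; rewrite row0 row_mul; apply/(dif_exact resF).
by exists (delta_mx 0 k); rewrite -rowE.
Qed.

Lemma dif_const i : map_mx (mcoeff (@mnm0 n)) (dif F i) = 0.
Proof.
apply/matrixP => k l; rewrite !mxE; apply/irrelevantP; exact: (dif_min resF).
Qed.

(** A lift of the identity of R/J from F to itself is homotopic to the identity.
Here h is the homotopy out of degree i, and E is the contribution of the
homotopy out of degree i - 1, which the differential annihilates and which has
no constant terms because the resolution is minimal. *)
Lemma aug_lift_id i (A : 'M_(rk F i, rk F i)) :
  aug_lift A -> exists h E, [/\ A - 1%:M = h *m dif F i + E,
    dif F i *m E = 0 & map_mx (mcoeff (@mnm0 n)) E = 0].
Proof.
elim=> {i A} [A AJ|i A B _ [h [E [hE dE E0]]] BA].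
  have [|h hA] := @aug_factor _ (A - 1%:M).
    move=> k.
    have -> : ((A - 1%:M) *m aug F) k 0 = -1 * (aug F - A *m aug F) k 0.
      by rewrite mulmxBl mul1mx mulN1r !mxE opprB.
    exact: monidealM.
  by exists h, 0; rewrite hA addr0 mulmx0 map_mx0.
have [|h' h'B] := @dif_factor _ i (B - 1%:M - dif F i *m h).
  rewrite mulmxBl mulmxBl BA mul1mx -mulmxA.
  rewrite -[X in _ - X - _]mulmx1 -!mulmxBr hE.
  by rewrite [_ + E]addrC addrK.
exists h', (dif F i *m h); rewrite -h'B subrK mulmxA dif_comp mul0mx map_mxM.
by rewrite dif_const mul0mx.
Qed.

Lemma aug_lift_const i (A : 'M_(rk F i, rk F i)) :
  aug_lift A -> map_mx (mcoeff (@mnm0 n)) A = 1%:M.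
Proof.
case/aug_lift_id => h [E [hE _ E0]].
have -> : A = 1%:M + (h *m dif F i + E) by rewrite -hE addrC subrK.
by rewrite !map_mxD map_mxM dif_const mulmx0 E0 !addr0 map_mx1.
Qed.

End Factoring.

(** A homogeneous map that factors through the differential has a homogeneous
factor, since discarding the other components of a factor commutes with
multiplication by the differential. *)
Lemma homogenize_lift F G i (C : 'M[mpoly n K]_(rk F i.+1, rk G i)) :
  min_resolution J G ->
  (forall k l, homog (sh k - sh l) (C k l)) ->
  (exists B, C = B *m dif G i) ->
  exists2 B, B *m dif G i = C & forall k l, homog (sh k - sh l) (B k l).
Proof.
move=> resG hC [B CB].
exists (hcomp_mx (@sh _ _ F i.+1) (@sh _ _ G i.+1) B); last exact: hcomp_mx_homog.
by rewrite (hcomp_mxM _ _ (@dif_homog _ _ _ _ resG i)) -CB hcomp_mx_id.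
Qed.

Lemma aug_lift0 F G : min_resolution J F -> min_resolution J G ->
  exists2 A : 'M_(rk F 0, rk G 0),
    forall k, J ((aug F - A *m aug G) k 0) &
    forall k l, homog (sh k - sh l) (A k l).
Proof.
move=> resF resG.
have /choice [u uP] := fun k => aug_surj resG (aug F k 0).
pose A := \matrix_k u k.
exists (hcomp_mx (@sh _ _ F 0) (@sh _ _ G 0) A); last exact: hcomp_mx_homog.
move=> k.
have hG k' (l : 'I_1) : homog (@sh _ _ G 0 k' - 0) (aug G k' l).
  by rewrite subr0 ord1; apply: (aug_homog resG).
have hF k' (l : 'I_1) : homog (@sh _ _ F 0 k' - 0) (aug F k' l).
  by rewrite subr0 ord1; apply: (aug_homog resF).
rewrite (hcomp_mxM _ _ hG) -{1}(hcomp_mx_id hF) !mxE -raddfB.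
apply: monideal_hcomp; have := uP k; congr (J (_ - _)).
by rewrite -[u k](rowK u) -row_mul !mxE.
Qed.

Lemma aug_liftS F G i (A : 'M_(rk F i, rk G i)) :
  min_resolution J F -> min_resolution J G ->
  aug_lift A -> (forall k l, homog (sh k - sh l) (A k l)) ->
  exists2 B, B *m dif G i = dif F i *m A &
    forall k l, homog (sh k - sh l) (B k l).
Proof.
move=> resF resG lA hA; apply: homogenize_lift => // [k l|].
  rewrite -(hcomp_mx_id (@dif_homog _ _ _ _ resF i)) (hcomp_mxM _ _ hA).
  exact: hcomp_mx_homog.
case: i A / lA hA => [A AJ _|i A B lA BA _].
  apply: aug_factor => // k.
  have -> : dif F 0 *m A *m aug G =
      dif F 0 *m aug F + (- dif F 0) *m (aug F - A *m aug G).
    by rewrite mulNmx mulmxBr opprB addrC subrK mulmxA.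
  by rewrite mxE; apply: monidealD; [apply: dif_aug|apply: monideal_mulmx].
by apply: dif_factor => //; rewrite -mulmxA BA mulmxA (dif_comp resF) mul0mx.
Qed.

Lemma aug_lift_pair F G i : min_resolution J F -> min_resolution J G ->
  exists (A : 'M_(rk F i, rk G i)) (B : 'M_(rk G i, rk F i)),
    [/\ aug_lift A, forall k l, homog (sh k - sh l) (A k l),
        aug_lift B, forall k l, homog (sh k - sh l) (B k l) &
        aug_lift (A *m B)].
Proof.
move=> resF resG; elim: i => [|i [A [B [lA hA lB hB lAB]]]].
  have [A AJ hA] := aug_lift0 resF resG; have [B BJ hB] := aug_lift0 resG resF.
  exists A, B; split=> //; apply: AugLift0 => // k.
  have -> : aug F - A *m B *m aug F =
      (aug F - A *m aug G) + A *m (aug G - B *m aug F).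
    by rewrite mulmxBr addrA subrK mulmxA.
  by rewrite mxE; apply: monidealD => //; apply: monideal_mulmx.
have [A' dA hA'] := aug_liftS resF resG lA hA.
have [B' dB hB'] := aug_liftS resG resF lB hB.
exists A', B'; split=> //; [exact: AugLiftS dA|exact: AugLiftS dB|].
by apply: AugLiftS lAB _; rewrite -mulmxA dB mulmxA dA mulmxA.
Qed.

(** The composite A B of two lifts has constant term 1 at (k, k), so for some l the
entry A k l has a nonzero constant term; as A is homogeneous of degree 0, the
basis elements k and l have the same degree. *)
Lemma min_resolution_degrees F G i (k : 'I_(rk F i)) :
  min_resolution J F -> min_resolution J G ->
  exists l : 'I_(rk G i), sh l = sh k.
Proof.
move=> resF resG; have [A [B [_ hA _ _ lAB]]] := aug_lift_pair i resF resG.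
have /matrixP/(_ k k) := aug_lift_const resF lAB.
rewrite map_mxM !mxE eqxx => AB1.
have [l Akl] : exists l, mcoeff (@mnm0 n) (A k l) != 0.
  apply/existsP; apply: contraT => /existsPn A0.
  move: AB1; rewrite big1 => [/esym/eqP|l _]; first by rewrite oner_eq0.
  have /negPn/eqP Al := A0 l.
  by rewrite [map_mx _ A k l](_ : _ = 0) ?mul0r // mxE.
exists l; move: Akl; rewrite -mcoeff_msupp => /hA; rewrite mdeg0.
by move/esym/eqP; rewrite subr_eq0 => /eqP.
Qed.

End Comparison.

(** * Regularity under relabelling *)

Lemma int_supremums_neq0 (A : set (\bar int)) :
  A !=set0 -> (forall x, A x -> exists k : int, x = k%:E) -> supremums A !=set0.
Proof.
move=> [x Ax] Afin; have [a0 a0E] := Afin x Ax.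
have Aa0 : A a0%:E by rewrite -a0E.
have [[k Ak]|unb] := pselect (exists k : int, ubound A k%:E); last first.
  exists +oo%E; split=> [z _|y Ay]; first exact: leey.
  case: y Ay => [k Ak||Ay]; [by case: unb; exists k|by []|].
  by have := Ay _ Aa0.
pose P m := `[< A (a0 + m%:Z)%:E >].
have exP : exists m, P m by exists 0%N; apply/asboolP; rewrite addr0.
have ubP m : P m -> (m <= `|k - a0|)%N.
  move=> /asboolP /Ak; rewrite lee_fin -lerBrDl => le_m.
  by rewrite -lez_nat gez0_abs // (le_trans _ le_m).
case: (ex_maxnP exP ubP) => m /asboolP Am mmax.
exists (a0 + m%:Z)%:E; split=> [z Az|y]; last exact.
have [b bE] := Afin z Az; move: Az; rewrite bE lee_fin => Ab.
have [ab|/ltW ba] := lerP a0 b; last by rewrite (le_trans ba) // lerDl.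
have bm : b = a0 + `|b - a0|%N by rewrite gez0_abs ?subr_ge0 // addrCA subrr addr0.
rewrite bm lerD2l lez_nat; apply: mmax; apply/asboolP; by rewrite -bm.
Qed.

Lemma le_int_supremum (A B : set (\bar int)) :
  (forall x, A x -> exists k : int, x = k%:E) ->
  (forall x, B x -> exists k : int, x = k%:E) ->
  (forall x, A x -> exists2 y, B y & (x <= y)%E) ->
  (supremum -oo A <= supremum -oo B)%E.
Proof.
move=> Afin Bfin AB; have [->|/set0P A0] := eqVneq A set0.
  by rewrite supremum0 leNye.
have B0 : B !=set0 by have [x /AB[y By _]] := A0; exists y.
have supA : supremums A (supremum -oo A)%E.
  rewrite /supremum ifF; last exact/negbTE/set0P.
  by have [s sA] := int_supremums_neq0 A0 Afin; apply: xgetI sA.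
apply: supA.2 => x /AB[y By xy]; apply: le_trans xy _.
exact: (ge_supremum_Nmem _ (int_supremums_neq0 B0 Bfin)).
Qed.

Section RegularityOfRelabelling.
Context (K : fieldType) (n : nat) (psi : 'I_n -> nat -> nat).
Hypothesis psi_incr : forall t, {homo psi t : x y / (x < y)%N}.

(** The two resolutions have the same ranks, and the relabelled basis elements have
degrees at least as large. *)
Lemma reg_relabel N (S : set (multinom n)) :
  (forall s, S s -> forall i, (s i <= N)%N) -> ~ S (@mnm0 n) ->
  (reg_quotient (@monideal K n S) <=
   reg_quotient (@monideal K n [set relabel psi s | s in S]))%E.
Proof.
move=> SN S0; have [F resF] := frame_exists K SN S0.
apply: le_int_supremum.
- by move=> _ [G [i [j [_ _ ->]]]]; exists (j - i%:Z).
- by move=> _ [G [i [j [_ _ ->]]]]; exists (j - i%:Z).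
move=> _ [G [i [j [resG /pred0Pn[k /eqP kj] ->]]]].
have [l lk] := min_resolution_degrees k resG (frame_min_resolution resF).
pose F' := relabel_frame psi F; have resF' := relabel_frame_resolves psi_incr resF.
pose j' := (mdeg (@fdeg _ _ F' i l))%:Z.
exists (j' - i%:Z)%:E.
  exists (frame_seq F'), i, j'; split=> //; first exact: frame_min_resolution.
  by apply/pred0Pn; exists l; apply/eqP.
rewrite lee_fin lerB // -kj -lk /= /j' lez_nat.
case: i k l kj lk @j' => [|i] k l _ _ /=; last exact: mdeg_relabel.
by rewrite (fdeg0 resF).
Qed.

End RegularityOfRelabelling.

(** * Minimal generators and incidence matrices *)

Section MinimalGenerators.
Context (K : fieldType) (n : nat).
Implicit Types (S : set (multinom n)) (I : set (mpoly n K)).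

Lemma lem_neq_mdeg (a b : multinom n) : lem a b -> a != b -> (mdeg a < mdeg b)%N.
Proof.
move=> /submK ab; rewrite -{2}ab mdegD; apply: contraNT.
rewrite -leqNgt -{2}[mdeg a]add0n leq_add2r leqn0 mdeg_eq0 => /eqP d0.
by rewrite -ab d0 add0m.
Qed.

(** Fix s0 in S. An element of S that s0 does not divide has some exponent a_i = c
smaller than that of s0, so S is covered by the multiples of s0 and finitely
many subsets on which one more exponent is constant. Hence the induction on the
number of exponents that are not constant, E being the set of those that are. *)
Lemma dickson S : exists2 s : seq (multinom n), (forall x, x \in s -> S x) &
  forall a, S a -> exists2 x, x \in s & lem x a.
Proof.
suff agree k (E : {set 'I_n}) S' : (#|~: E| <= k)%N ->
    (forall a b, S' a -> S' b -> forall i, i \in E -> a i = b i) ->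
    exists2 s : seq (multinom n), (forall x, x \in s -> S' x) &
      forall a, S' a -> exists2 x, x \in s & lem x a.
  by apply: (agree _ finset.set0) (leqnn _) _ => a b _ _ i; rewrite inE.
elim: k E S' => [|k IH] E S' leE agree.
  have [[s0 Ss0]|nS] := pselect (exists a, S' a); last first.
    by exists [::] => // a Sa; case: nS; exists a.
  exists [:: s0] => [x|a Sa]; first by rewrite inE => /eqP ->.
  exists s0; first by rewrite inE.
  apply/mnm_lepP => i; rewrite (agree _ _ Ss0 Sa) //.
  by move: leE; rewrite leqn0 cards_eq0 => /eqP/setP/(_ i); rewrite !inE => /negPn.
have [[s0 Ss0]|nS] := pselect (exists a, S' a); last first.
  by exists [::] => // a Sa; case: nS; exists a.
have /choice [f fP] : forall ic : 'I_n * nat, exists s : seq (multinom n),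
    (forall x, x \in s -> S' x) /\ (forall a, S' a -> (a ic.1 < s0 ic.1)%N ->
       a ic.1 = ic.2 -> exists2 x, x \in s & lem x a).
  move=> [i c] /=; have [iE|iE] := boolP (i \in E).
    by exists [::]; split=> // a Sa; rewrite (agree _ _ Sa Ss0) ?ltnn.
  have [||s sS sP] := IH (i |: E)%SET [set a | S' a /\ a i = c].
  - apply: leq_trans (_ : #|~: E :\ i| <= _)%N.
      by apply: subset_leq_card; apply/fintype.subsetP => x; rewrite !inE negb_or.
    by move: leE; rewrite (cardsD1 i (~: E)) inE iE.
  - move=> a b [Sa ai] [Sb bi] t; rewrite !inE => /orP[/eqP ->|].
      by rewrite ai.
    exact: agree.
  exists s; split=> [x /sS[]//|a Sa _ ai]; exact: sP.
exists (s0 :: flatten [seq flatten [seq f (i, c) | c <- iota 0 (s0 i)] |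
                        i <- enum 'I_n]).
  move=> x; rewrite inE => /orP[/eqP ->//|/flatten_mapP[i _ /flatten_mapP[c _]]].
  by case: (fP (i, c)) => + _; apply.
move=> a Sa; have [s0a|] := boolP (lem s0 a).
  by exists s0; rewrite ?inE ?eqxx.
rewrite /lem => /forallPn[i]; rewrite -ltnNge => ai.
have [x xf xa] := (fP (i, a i)).2 a Sa ai erefl.
exists x => //; rewrite inE; apply/orP; right.
apply/flatten_mapP; exists i; first by rewrite mem_enum.
by apply/flatten_mapP; exists (a i) => //; rewrite mem_iota.
Qed.

Lemma eq_monideal S S' :
  (forall b, (exists2 s, S s & lem s b) <-> (exists2 s, S' s & lem s b)) ->
  @monideal K n S = monideal S'.
Proof.
move=> SS'; apply/seteqP; split=> p /monidealP Sp; apply/monidealP => m /Sp.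
  by move/SS'.
by move/(SS' m).
Qed.

Lemma min_generators_antichain I S a b :
  min_generators I S -> S a -> S b -> lem a b -> a = b.
Proof.
move=> [SI Smin] Sa Sb ab; apply/eqP; apply: contraT => /eqP neq.
have : S b by []; rewrite -(Smin [set s | S s /\ s <> b]).
- by case.
- by move=> s [].
rewrite -SI; apply: eq_monideal => c; split=> [[s [Ss _] sc]|[s Ss sc]].
  by exists s.
have [sb|sb] := pselect (s = b); last by exists s.
by exists a; [split|rewrite sb in sc; apply: lepm_trans sc].
Qed.

Lemma min_generators_unique I S S' :
  min_generators I S -> min_generators I S' -> S `<=` S'.
Proof.
move=> mS mS' a Sa.
have : exists2 s, S' s & lem s a.
  apply/(monidealX K); rewrite mS'.1 -mS.1; apply/monidealX.
  by exists a => //; apply: lepm_refl.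
move=> [s Ss sa].
have : exists2 t, S t & lem t s.
  apply/(monidealX K); rewrite mS.1 -mS'.1; apply/monidealX.
  by exists s => //; apply: lepm_refl.
move=> [t St ts].
have ta := min_generators_antichain mS St Sa (lepm_trans ts sa).
rewrite ta in ts; suff -> : a = s by [].
apply/mnmP => i; apply/eqP; rewrite eqn_leq.
by move/mnm_lepP: ts => ->; move/mnm_lepP: sa => ->.
Qed.

Lemma incidence_matrix_exists I : monomial_ideal I ->
  exists (q : nat) (A : 'M[nat]_(n, q)), incidence_matrix I A.
Proof.
move=> [S ->]; have [s sS sP] := dickson S.
pose r := [seq x <- undup s | ~~ has (fun y => (y != x) && lem y x) s].
have rP x : x \in s -> exists2 y, y \in r & lem y x.
  have [N] := ubnP (mdeg x); elim: N x => // N IH x lexN xs.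
  have [|] := boolP (has (fun y => (y != x) && lem y x) s); last first.
    move=> xN; exists x; last exact: lepm_refl.
    by rewrite mem_filter xN mem_undup.
  case/hasP => y ys /andP[y_x yx].
  have [|z zr zy] := IH y _ ys; last by exists z => //; apply: lepm_trans yx.
  exact: leq_trans (lem_neq_mdeg yx y_x) _.
have r_anti x y : x \in r -> y \in r -> lem x y -> x = y.
  rewrite !mem_filter !mem_undup => /andP[_ xs] /andP[/hasPn/(_ x xs) + _] xy.
  by rewrite xy andbT negbK => /eqP.
pose A : 'M[nat]_(n, size r) := \matrix_(i, j) tnth (in_tuple r) j i.
have colA j : column A j = tnth (in_tuple r) j.
  by apply/mnmP => i; rewrite mnmE mxE.
have rangeA : range (column A) = [set x | x \in r].
  apply/seteqP; split=> [_ [j _ <-]|x /= xr]; first by rewrite /= colA mem_tnth.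
  have /tnthP[j ->] : x \in in_tuple r by [].
  by exists j.
exists (size r), A; split.
  move=> j k; rewrite !colA => /eqP; rewrite !(tnth_nth (@mnm0 n)) nth_uniq //.
    by move/eqP/val_inj.
  exact/filter_uniq/undup_uniq.
rewrite rangeA; split=> [|T Tr TI].
  apply: eq_monideal => b; split=> [[x xr xb]|[a Sa ab]].
    exists x => //; apply: sS; move: xr.
    by rewrite /= mem_filter mem_undup => /andP[].
  have [x xs xa] := sP a Sa; have [y yr yx] := rP x xs.
  by exists y => //; apply: lepm_trans (lepm_trans yx xa) ab.
apply/seteqP; split=> // x xr.
have : exists2 t, T t & lem t x.
  apply/(monidealX K); rewrite TI; apply/monidealX.
  exists x; last exact: lepm_refl.
  by apply: sS; move: xr; rewrite /= mem_filter mem_undup => /andP[].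
by move=> [t Tt tx]; rewrite -(r_anti t x (Tr t Tt) xr tx).
Qed.

End MinimalGenerators.

(** * Signatures *)

Section Signature.
Context (K : fieldType) (n : nat).
Implicit Types I : set (mpoly n K).

Definition row_entries q (A : 'M[nat]_(n, q)) (i : 'I_n) : seq nat :=
  sort leq (undup [seq A i k | k <- enum 'I_q]).

(** The inverse of the signature in row i, which sends k to m_k; beyond the last
m_r it is continued so as to remain strictly increasing. *)
Definition unsgn q (A : 'M[nat]_(n, q)) (i : 'I_n) (k : nat) : nat :=
  let m := row_entries A i in
  if (k < size m)%N then nth 0%N m k else (k + last 0%N m)%N.

Lemma mem_row_entries q (A : 'M[nat]_(n, q)) i j : A i j \in row_entries A i.
Proof. by rewrite mem_sort mem_undup map_f // mem_enum. Qed.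

Lemma row_entries_sorted q (A : 'M[nat]_(n, q)) i : sorted ltn (row_entries A i).
Proof.
by rewrite ltn_sorted_uniq_leq sort_uniq undup_uniq sort_sorted.
Qed.

Lemma unsgn_incr q (A : 'M[nat]_(n, q)) i : {homo unsgn A i : x y / (x < y)%N}.
Proof.
move=> x y xy; rewrite /unsgn; set m := row_entries A i.
have nth_mono : {in [pred k | (k < size m)%N] &, {homo nth 0%N m : x y / (x < y)%N}}.
  exact: sorted_ltn_nth ltn_trans _ _ (row_entries_sorted A i).
have [ym|my] := ltnP y (size m).
  by rewrite (ltn_trans xy) // nth_mono ?inE // (ltn_trans xy).
have [xm|mx] := ltnP x (size m); last by rewrite ltn_add2r.
(* x indexes an entry of the row and y does not: m_x <= m_r < y + m_r *)
rewrite -nth_last -[X in (X < _)%N]add0n -addSn leq_add //.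
  exact: leq_trans xy.
have : (x <= (size m).-1)%N by case: (size m) xm.
rewrite leq_eqVlt => /orP[/eqP <- //|xl]; apply/ltnW/nth_mono => //; rewrite inE.
by case: (size m) xm.
Qed.

Lemma unsgn_sgn q (A : 'M[nat]_(n, q)) j :
  relabel (unsgn A) (column (sgn_mx A) j) = column A j.
Proof.
apply/mnmP => i; rewrite relabelE !mnmE mxE /unsgn -/(row_entries A i).
by rewrite index_mem mem_row_entries nth_index // mem_row_entries.
Qed.

(** Since I has only one minimal set of generators, all its incidence matrices have
the same columns, hence the same entries in each row. *)
Lemma sgn_idealE I q (A : 'M[nat]_(n, q)) :
  incidence_matrix I A -> sgn_ideal I = monideal (range (column (sgn_mx A))).
Proof.
move=> [injA genA]; rewrite /sgn_ideal; congr monideal.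
apply/seteqP; split=> [_ [q' [A' [j' [[_ genA'] ->]]]]|_ [j _ <-]]; last first.
  by exists q, A, j.
have sub (p p' : nat) (B : 'M[nat]_(n, p)) (B' : 'M[nat]_(n, p')) i :
    min_generators I (range (column B)) -> min_generators I (range (column B')) ->
    {subset [seq B i k | k <- enum 'I_p] <= [seq B' i k | k <- enum 'I_p']}.
  move=> gB gB' _ /mapP[k _ ->].
  have [k' _ kk'] : range (column B') (column B k).
    by apply: (min_generators_unique gB gB'); exists k.
  apply/mapP; exists k'; first by rewrite mem_enum.
  by move/mnmP/(_ i): kk'; rewrite !mnmE.
have [j _ jj'] : range (column A) (column A' j').
  by apply: (min_generators_unique genA' genA); exists j'.
exists j => //; apply/mnmP => i; rewrite !mnmE !mxE.
have -> : A i j = A' i j' by move/mnmP/(_ i): jj'; rewrite !mnmE.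
congr index; apply/(perm_sortP leq_total leq_trans anti_leq).
apply: uniq_perm; rewrite ?undup_uniq // => x; rewrite !mem_undup.
by apply/idP/idP; apply: sub.
Qed.

End Signature.

Theorem theorem2p29 (K : fieldType) (n : nat) (I : set (mpoly n K))
  (monI : monomial_ideal I) (nonprincipalI : ~ principal I) :
  (reg_quotient I >= reg_quotient (sgn_ideal I))%E.
Proof.
have [q [A incA]] := incidence_matrix_exists monI.
have [_ [IE _]] := incA; rewrite (sgn_idealE incA).
have <- : monideal [set relabel (unsgn A) s | s in range (column (sgn_mx A))] = I.
  rewrite -IE image_comp; congr monideal.
  by apply: eq_imagel => j _; rewrite /= unsgn_sgn.
apply: (reg_relabel _ (@unsgn_incr _ _ A) (N := q)) => [_ [j _ <-] i|[j _ j0]].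
  rewrite mnmE mxE; apply: leq_trans (index_size _ _) _; rewrite size_sort.
  by apply: leq_trans (size_undup _) _; rewrite size_map size_enum_ord.
case: nonprincipalI; exists (mpolyX K (column A j)).
(* column j of sgn(A) is 0, so column j of A divides every column of A *)
rewrite -IE -image_set1; apply: eq_monideal => b.
split=> [[_ [k _ <-] kb]|[_ -> jb]]; last by exists (column A j); [exists j|].
exists (column A j) => //; apply: lepm_trans kb.
rewrite -(unsgn_sgn A j) -(unsgn_sgn A k) relabel_le; last exact: unsgn_incr.
by rewrite j0; apply/mnm_lepP => i; rewrite mnm0E.
Qed.
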